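(* Assume $r(y,x_0)\in[-D,D]$, $\lambda>0$, and that there is $L>0$ such that for every intermediate state $x_s$ visited and every $x_0$, $l(x_0)=p_{\mathrm{ref}}(x_0\mid y,x_s)/p_{\mathrm{small}}(x_0\mid y,x_s)\le L$ (with $p_{\mathrm{small}}$ positive wherever $p_{\mathrm{ref}}$ is). Let $q(x_0\mid y)$ be the law of the output of Algorithm 2 with $M$ candidates, $K$ proposal samples per energy estimate, and $I$ guidance steps. For $\epsilon>0$ define $$g(\epsilon,M,K,L,\lambda,D)=\frac{e^{D/\lambda}-e^{-D/\lambda}}{2}\sqrt{\frac{4K\epsilon^2}{ML^2e^{2D/\lambda}}},$$ and suppose $C-\epsilon-g(\epsilon,M,K,L,\lambda,D)>0$. Then $$\mathsf{TV}\big(q(x_0\mid y)\,\|\,p(x_0\mid y)\big)\le I\left(\frac{2\epsilon+g(\epsilon,M,K,L,\lambda,D)}{C-\epsilon-g(\epsilon,M,K,L,\lambda,D)}\right)+4I\exp\!\left(-\frac{2K\epsilon^2}{L^2e^{2D/\lambda}}\right).$$ In particular, choosing $\epsilon=\tilde{\mathcal O}(1/\sqrt K)$ gives $g=\tilde{\mathcal O}(1/\sqrt M)$ and $\mathsf{TV}(q\|p)=\tilde{\mathcal O}(I/\sqrt M+I/\sqrt K)$.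
   Context: Setting: MLM framework with backward generation $x_T\to\cdots\to x_0$, $x_T$ the fixed fully masked sequence; reference model $p_{\mathrm{ref}}$, proposal model $p_{\mathrm{small}}$, query $y$. Target $p(x_0\mid y)=p_{\mathrm{ref}}(x_0\mid y)\exp(r(y,x_0)/\lambda)/C$ with $C=\sum_{x_0}p_{\mathrm{ref}}(x_0\mid y)\exp(r(y,x_0)/\lambda)$. Energy $\mathcal E(y,x_s)=\mathbb E_{p_{\mathrm{ref}}(x_0\mid y,x_s)}[\exp(r(y,x_0)/\lambda)]$ and its importance-sampling estimate $\widehat{\mathcal E}_{\mathrm{small}}(y,x_s)=\frac1K\sum_{k=1}^K\frac{p_{\mathrm{ref}}(x_0(k)\mid y,x_s)}{p_{\mathrm{small}}(x_0(k)\mid y,x_s)}\exp(r(y,x_0(k))/\lambda)$ with $x_0(k)$ i.i.d. from $p_{\mathrm{small}}(\cdot\mid y,x_s)$. Algorithm 2 (ETS-IS): timesteps $t_i=iT/I$; start at $x_{t_I}=x_T$; for $i=I,\dots,1$: draw $M$ candidates i.i.d. from $p_{\mathrm{ref}}(x_{t_{i-1}}\mid y,x_{t_i})$, compute $\widehat{\mathcal E}_{\mathrm{small}}$ for each, select candidate $m$ with probability proportional to its estimate, and set $x_{t_{i-1}}$ to it; output $x_0$. $\mathsf{TV}(p\|q)=\frac12\sum_x|p(x)-q(x)|$. *)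

(* Defs.v *)
From HB Require Import structures.
From mathcomp Require Import all_boot all_order all_algebra.
From mathcomp Require Import reals sequences exp.
Unset Printing Implicit Defensive.
Import Order.TTheory GRing.Theory Num.Theory.
Local Open Scope ring_scope.

(* Discrete setting (query y fixed and suppressed).
   X      : finite set of (partially masked) sequences.
   Grid levels n = 0..I correspond to the timesteps t_n = n T / I;
   level I holds the fixed fully masked sequence xT, level 0 the clean x_0.
   Pref n x x' := p_ref(x_{t_{n-1}} = x' | y, x_{t_n} = x)   (n = 1..I)
   Psmall n x x0 := p_small(x_0 = x0 | y, x_{t_n} = x)      (n = 0..I-1)
   r x0 := r(y, x0). *)

Section ETS.
Variables (R : realType) (X : finType).

Definition kernel := nat -> X -> X -> R.

Definition is_dist (mu : X -> R) : Prop :=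
  (forall x, 0 <= mu x) /\ \sum_(x : X) mu x = 1.

(* p_ref(x_0 | y, x_{t_n} = x): the reference denoising chain along the grid *)
Fixpoint pref_post (Pref : kernel) (n : nat) (x x0 : X) : R :=
  match n with
  | 0 => (x == x0)%:R
  | n'.+1 => \sum_(x' : X) Pref n'.+1 x x' * pref_post Pref n' x' x0
  end.

(* probability that the reference chain started at xT (level I) is at x
   after k steps, i.e. at level I - k *)
Fixpoint pref_fwd (Pref : kernel) (I : nat) (xT : X) (k : nat) (x : X) : R :=
  match k with
  | 0 => (x == xT)%:R
  | k'.+1 => \sum_(x' : X) pref_fwd Pref I xT k' x' * Pref (I - k')%N x' x
  end.

Definition wgt (r : X -> R) (lam : R) (x0 : X) : R := expR (r x0 / lam).

Definition Cnorm (Pref : kernel) (r : X -> R) (lam : R) (I : nat) (xT : X) : R :=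
  \sum_(x0 : X) pref_post Pref I xT x0 * wgt r lam x0.

Definition target (Pref : kernel) (r : X -> R) (lam : R) (I : nat) (xT : X)
  (x0 : X) : R :=
  pref_post Pref I xT x0 * wgt r lam x0 / Cnorm Pref r lam I xT.

(* importance-sampling energy estimate at state x on level n,
   from K samples z : 'I_K -> X drawn from Psmall n x *)
Definition est (Pref Psmall : kernel) (r : X -> R) (lam : R) (K n : nat)
  (x : X) (z : {ffun 'I_K -> X}) : R :=
  K%:R^-1 * \sum_(k < K)
     (pref_post Pref n x (z k) / Psmall n x (z k)) * wgt r lam (z k).

(* selection probability of candidate m given the M estimates e
   (convention: uniform if all estimates vanish) *)
Definition select (M : nat) (e : {ffun 'I_M -> R}) (m : 'I_M) : R :=
  if \sum_(j < M) e j == 0 then M%:R^-1 else e m / \sum_(j < M) e j.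

Definition ets_step (Pref Psmall : kernel) (r : X -> R) (lam : R) (M K n : nat)
  (x x' : X) : R :=
  \sum_(c : {ffun 'I_M -> X}) \sum_(z : {ffun 'I_M -> {ffun 'I_K -> X}})
    ((\prod_(m < M) Pref n x (c m)) *
     (\prod_(m < M) \prod_(k < K) Psmall n.-1 (c m) (z m k)) *
     \sum_(m < M | c m == x')
        select M [ffun j => est Pref Psmall r lam K n.-1 (c j) (z j)] m).

Fixpoint ets_law (Pref Psmall : kernel) (r : X -> R) (lam : R) (M K n : nat)
  (x x0 : X) : R :=
  match n with
  | 0 => (x == x0)%:R
  | n'.+1 => \sum_(x' : X) ets_step Pref Psmall r lam M K n'.+1 x x' *
                            ets_law Pref Psmall r lam M K n' x' x0
  end.

Definition TV (p q : X -> R) : R := 2^-1 * \sum_(x : X) `|p x - q x|.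

End ETS.

Arguments is_dist {R X}.
Arguments pref_post {R X}.
Arguments pref_fwd {R X}.
Arguments wgt {R X}.
Arguments Cnorm {R X}.
Arguments target {R X}.
Arguments est {R X}.
Arguments select {R}.
Arguments ets_step {R X}.
Arguments ets_law {R X}.
Arguments TV {R X}.

Definition gfun (R : realType) (eps : R) (M K : nat) (L lam D : R) : R :=
  (expR (D / lam) - expR (- (D / lam))) / 2 *
  Num.sqrt (4 * K%:R * eps ^+ 2 / (M%:R * L ^+ 2 * expR (2 * D / lam))).
Arguments gfun {R}.

(* Main.v *)
Require Import Defs.
From HB Require Import structures.
From mathcomp Require Import all_boot all_order all_algebra.
From mathcomp Require Import reals sequences exp.
From mathcomp Require Import ring lra.
Import Order.TTheory GRing.Theory Num.Theory.
Local Open Scope ring_scope.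

(** One guidance step draws candidates [c_1, ..., c_M] with unbiased energy
    estimates [e_1, ..., e_M]. With [S] the average of the [e_j] and [c] the
    energy of the current state, picking candidate [m] with probability
    [e_m / (M S)] instead of [e_m / (M c)] -- the latter has exactly the target
    transition as its expectation -- costs [E|S - c| / c] in l1 norm, and
    [E|S - c|] is at most the standard deviation of [S], which is
    [O(1/sqrt M)]. Weighted by the energy of their starting states the one-step
    errors add up along the reference chain, so only the global constant [C]
    appears in the denominator. This gives the bound as soon as
    [2 K eps^2 / (L^2 e^(2D/lam)) >= 1/2]; otherwise its right-hand side
    exceeds 1. *)

(** * Moments of independent samples *)

Section IID.
Variables (R : realType) (T : finType) (mu : T -> R).
Hypothesis mu_dist : is_dist mu.

Definition iid (n : nat) (w : {ffun 'I_n -> T}) : R := \prod_(j < n) mu (w j).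

Definition avg (n : nat) (f : T -> R) (w : {ffun 'I_n -> T}) : R :=
  n%:R^-1 * \sum_(j < n) f (w j).

(** Independence in the form that gives every moment below: take [phi] trivial outside one or two
    coordinates. *)
Lemma iid_prod n (phi : 'I_n -> T -> R) :
  \sum_w iid n w * \prod_(j < n) phi j (w j) =
  \prod_(j < n) \sum_t mu t * phi j t.
Proof.
rewrite bigA_distr_bigA; apply: eq_bigr => w _.
by rewrite /iid -big_split.
Qed.

Lemma iid_dist n : is_dist (iid n).
Proof.
have [mu0 mu1] := mu_dist; split=> [w|]; first exact: prodr_ge0.
have := iid_prod n (fun _ _ => 1).
rewrite (eq_bigr (fun w => iid n w)) => [->|w _]; last by rewrite big1 ?mulr1.
by apply: big1 => j _; rewrite -[RHS]mu1; apply: eq_bigr => t _; rewrite mulr1.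
Qed.

Lemma iid_coord n (f : T -> R) i :
  \sum_w iid n w * f (w i) = \sum_t mu t * f t.
Proof.
have [_ mu1] := mu_dist.
have := iid_prod n (fun j t => if j == i then f t else 1).
rewrite [RHS](bigD1 i)//= eqxx [X in _ = _ * X -> _]big1 => [|j ji]; last first.
  rewrite (negPf ji) -[RHS]mu1; by apply: eq_bigr => t _; rewrite mulr1.
rewrite mulr1 => <-; apply: eq_bigr => w _; congr (_ * _).
by rewrite -big_mkcond big_pred1_eq.
Qed.

Lemma iid_coord2 n (f : T -> R) i j : i != j -> \sum_t mu t * f t = 0 ->
  \sum_w iid n w * (f (w i) * f (w j)) = 0.
Proof.
move=> ij f0.
have := iid_prod n (fun k t =>
  (if k == i then f t else 1) * (if k == j then f t else 1)).
rewrite [RHS](bigD1 i)//= eqxx (negPf ij) [X in _ = X * _ -> _](_ : _ = 0).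
  rewrite mul0r => E; rewrite -[RHS]E; apply: eq_bigr => w _; congr (_ * _).
  by rewrite big_split -!big_mkcond /= !big_pred1_eq.
by rewrite -[RHS]f0; apply: eq_bigr => t _; rewrite mulr1.
Qed.

Lemma iid_avg n (f : T -> R) : (0 < n)%N ->
  \sum_w iid n w * avg n f w = \sum_t mu t * f t.
Proof.
move=> n0; rewrite /avg.
under eq_bigr do rewrite mulrCA mulr_sumr.
rewrite -mulr_sumr exchange_big /=.
under eq_bigr do rewrite iid_coord.
rewrite sumr_const card_ord -[X in _ * X]mulr_natl mulKf //.
by rewrite pnatr_eq0 -lt0n.
Qed.

(** After centring, the cross terms vanish by independence, so only [n] diagonal terms survive the
    factor [1/n^2]. *)
Lemma iid_avg_var n (f : T -> R) (m := \sum_t mu t * f t) : (0 < n)%N ->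
  \sum_w iid n w * (avg n f w - m) ^+ 2 =
  n%:R^-1 * \sum_t mu t * (f t - m) ^+ 2.
Proof.
move=> n0; have [_ mu1] := mu_dist.
have nn0 : n%:R != 0 :> R by rewrite pnatr_eq0 -lt0n.
pose h t := f t - m.
have h0 : \sum_t mu t * h t = 0.
  rewrite /h; under eq_bigr do rewrite mulrBr.
  by rewrite sumrB -mulr_suml mu1 mul1r subrr.
have avgE w : (avg n f w - m) ^+ 2 =
    n%:R^-1 ^+ 2 * \sum_(i < n) \sum_(j < n) h (w i) * h (w j).
  have -> : avg n f w - m = n%:R^-1 * \sum_(i < n) h (w i).
    rewrite /avg /h sumrB sumr_const card_ord -[m *+ n]mulr_natl.
    by rewrite mulrBr mulKf.
  rewrite exprMn; congr (_ * _); rewrite expr2 mulr_suml.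
  by apply: eq_bigr => i _; rewrite mulr_sumr.
under eq_bigr do rewrite avgE mulrCA mulr_sumr.
rewrite -mulr_sumr exchange_big /=.
rewrite (eq_bigr (fun=> \sum_t mu t * h t ^+ 2)) => [|i _]; last first.
  under eq_bigr do rewrite mulr_sumr.
  rewrite exchange_big /= (bigD1 i)//= [X in _ + X]big1 => [|j ji]; last first.
    by apply: iid_coord2 => //; rewrite eq_sym.
  rewrite addr0 -(iid_coord n (fun t => h t ^+ 2) i).
  by under eq_bigr do rewrite -expr2.
rewrite sumr_const card_ord -[X in _ * X]mulr_natl mulrA.
by rewrite expr2 divfK.
Qed.

(** Averages the pointwise bound [|a| <= a^2 / (2s) + s/2], which is [(|a| - s)^2 >= 0] expanded. *)
Lemma mean_norm_le (a : T -> R) (s : R) : 0 < s ->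
  \sum_t mu t * a t ^+ 2 <= s ^+ 2 -> \sum_t mu t * `|a t| <= s.
Proof.
move=> s0 H; have [mu0 mu1] := mu_dist.
have le t : mu t * `|a t| <= (2 * s)^-1 * (mu t * a t ^+ 2) + s / 2 * mu t.
  have -> : (2 * s)^-1 * (mu t * a t ^+ 2) + s / 2 * mu t =
      mu t * `|a t| + mu t * ((2 * s)^-1 * (`|a t| - s) ^+ 2).
    rewrite -(real_normK (num_real (a t))); field; exact: lt0r_neq0.
  rewrite lerDl mulr_ge0// mulr_ge0 ?sqr_ge0// invr_ge0 mulr_ge0// ltW//.
apply: (le_trans (ler_sum _ (fun t _ => le t))).
rewrite big_split /= -!mulr_sumr mu1 mulr1.
suff : (2 * s)^-1 * \sum_t mu t * a t ^+ 2 <= s / 2 by lra.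
rewrite [leRHS](_ : _ = (2 * s)^-1 * s ^+ 2); last by field; exact: lt0r_neq0.
by rewrite ler_wpM2l// invr_ge0 mulr_ge0// ltW.
Qed.

(** The bound is asked only on the support of [mu], since importance ratios and reachability are
    controlled only there. *)
Lemma mean_ge (f : T -> R) (a : R) :
  (forall t, 0 < mu t -> a <= f t) -> a <= \sum_t mu t * f t.
Proof.
have [mu0 mu1] := mu_dist => H.
rewrite -[a]mulr1 -mu1 mulr_sumr; apply: ler_sum => t _.
have := mu0 t; rewrite le_eqVlt => /predU1P[<-|mt]; first by rewrite mulr0 mul0r.
by rewrite mulrC ler_pM2l// H.
Qed.

Lemma mean_le (f : T -> R) (b : R) :
  (forall t, 0 < mu t -> f t <= b) -> \sum_t mu t * f t <= b.
Proof.
move=> H; rewrite -lerN2 -sumrN.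
under eq_bigr do rewrite -mulrN.
by apply: mean_ge => t mt; rewrite lerN2 H.
Qed.

End IID.

Arguments iid {R T}.
Arguments avg {R T}.

(** * Selection with probability proportional to a score *)

Lemma sum_fibers (V : nmodType) (T X : finType) (phi : T -> X) (F : T -> V) :
  \sum_x \sum_(t | phi t == x) F t = \sum_t F t.
Proof. by rewrite [RHS](partition_big phi xpredT). Qed.

Section Selection.
Variables (R : realType) (M : nat).
Hypothesis M_gt0 : (0 < M)%N.

Lemma sum_select (e : {ffun 'I_M -> R}) : \sum_m select M e m = 1.
Proof.
rewrite /select; case: (boolP (\sum_j e j == 0)) => [_|S0]; last first.
  by rewrite -mulr_suml divff.
by rewrite sumr_const card_ord -[LHS]mulr_natl divff// pnatr_eq0 -lt0n.
Qed.

Lemma select_ge0 (e : {ffun 'I_M -> R}) m : (forall j, 0 <= e j) ->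
  0 <= select M e m.
Proof.
move=> e0; rewrite /select; case: ifP => _; first by rewrite invr_ge0.
by rewrite divr_ge0// sumr_ge0.
Qed.

(** With [S] the average score, each term equals [|S - c| * select M e m], and the selection
    probabilities sum to 1. If all scores vanish, the uniform convention keeps this identity
    true. *)
Lemma sum_select_dist (e : {ffun 'I_M -> R}) (c : R) :
  0 <= c -> (forall j, 0 <= e j) ->
  \sum_m `|c * select M e m - M%:R^-1 * e m| =
  `|M%:R^-1 * \sum_m e m - c|.
Proof.
move=> c0 e0; have Mn0 : M%:R != 0 :> R by rewrite pnatr_eq0 -lt0n.
have eq1 : \sum_m `|c * select M e m - M%:R^-1 * e m| =
    \sum_m `|M%:R^-1 * \sum_m e m - c| * select M e m.
  apply: eq_bigr => m _; have se0 := select_ge0 e m e0.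
  rewrite -{2}(ger0_norm se0) -normrM distrC; congr (`|_|).
  rewrite mulrBl; congr (_ - _); rewrite /select; case: ifPn => [/eqP S0|S0].
    have -> : e m = 0 by apply: (psumr_eq0P _ S0).
    by rewrite S0 mulr0 mul0r.
  by rewrite -mulrA [X in _ = _ * X]mulrC divfK.
by rewrite eq1 -mulr_sumr sum_select mulr1.
Qed.

End Selection.

(** * One resampling step with general nonnegative scores *)

Section Resampling.
Variables (R : realType) (T X : finType) (mu f : T -> R) (phi : T -> X) (M : nat).
Hypothesis mu_dist : is_dist mu.
Hypothesis f_ge0 : forall t, 0 <= f t.
Hypothesis M_gt0 : (0 < M)%N.

(** The map [phi] forgets the auxiliary randomness that a draw carries besides its candidate. *)
Definition resample (x : X) : R :=
  \sum_w iid mu M w *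
    \sum_(m < M | phi (w m) == x) select M [ffun j => f (w j)] m.

Lemma resample_dist : is_dist resample.
Proof.
have [i0 i1] := iid_dist R T mu mu_dist M; split=> [x|].
  apply: sumr_ge0 => w _; apply: mulr_ge0 => //.
  by apply: sumr_ge0 => m _; apply: select_ge0 => j; rewrite ffunE.
rewrite exchange_big /= -[RHS]i1; apply: eq_bigr => w _.
rewrite -mulr_sumr -[RHS]mulr1; congr (_ * _).
by rewrite (sum_fibers _ _ _ (fun m => phi (w m))) sum_select.
Qed.

(** The weights [e_m / M] are unbiased for the fibre sums, so the triangle inequality and
    [sum_select_dist] leave the mean of [|avg - c|], controlled by the variance of [f] divided by
    [M]. *)
Lemma resample_error (c := \sum_t mu t * f t) (s : R) : 0 < s ->
  \sum_t mu t * (f t - c) ^+ 2 <= M%:R * s ^+ 2 ->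
  \sum_x `|c * resample x - \sum_(t | phi t == x) mu t * f t| <= s.
Proof.
move=> s0 V; have [mu0 mu1] := mu_dist.
have [i0 i1] := iid_dist R T mu mu_dist M.
have c0 : 0 <= c by apply: sumr_ge0 => t _; rewrite mulr_ge0.
pose e (w : {ffun 'I_M -> T}) : {ffun 'I_M -> R} := [ffun j => f (w j)].
have diffE x : c * resample x - \sum_(t | phi t == x) mu t * f t =
    \sum_w iid mu M w * \sum_(m < M | phi (w m) == x)
      (c * select M (e w) m - M%:R^-1 * e w m).
  have -> : \sum_(t | phi t == x) mu t * f t =
      \sum_w iid mu M w * \sum_(m < M | phi (w m) == x) M%:R^-1 * e w m.
    (* Restricting [f] to the fibre over [x] turns the fibre sum into the mean of an i.i.d.
       average. *)
    pose fx t := if phi t == x then f t else 0.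
    rewrite big_mkcond /= (eq_bigr (fun t => mu t * fx t)) => [|t _]; last first.
      by rewrite /fx; case: ifP => //; rewrite mulr0.
    rewrite -(iid_avg R T mu mu_dist M fx M_gt0); apply: eq_bigr => w _.
    congr (_ * _); rewrite /avg mulr_sumr [RHS]big_mkcond /=.
    by apply: eq_bigr => m _; rewrite /fx /e ffunE; case: ifP => //; rewrite mulr0.
  rewrite mulr_sumr -sumrB; apply: eq_bigr => w _.
  by rewrite mulrCA -mulrBr mulr_sumr -sumrB.
apply: (@le_trans _ _ (\sum_w iid mu M w * `|avg M f w - c|)).
  apply: (@le_trans _ _ (\sum_x \sum_w iid mu M w *
      \sum_(m < M | phi (w m) == x) `|c * select M (e w) m - M%:R^-1 * e w m|)).
    apply: ler_sum => x _; rewrite diffE.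
    apply: (le_trans (ler_norm_sum _ _ _)); apply: ler_sum => w _.
    rewrite normrM (ger0_norm (i0 w)) ler_wpM2l//; exact: ler_norm_sum.
  rewrite exchange_big /=; apply: ler_sum => w _.
  rewrite -mulr_sumr (sum_fibers _ _ _ (fun m => phi (w m))).
  rewrite sum_select_dist// => [|j]; last by rewrite /e ffunE.
  rewrite /avg; under [X in _ * X - c]eq_bigr do rewrite /e ffunE.
  exact: lexx.
apply: (mean_norm_le R _ _ (iid_dist R T mu mu_dist M)) => //.
rewrite iid_avg_var// ler_pdivrMl ?ltr0n//.
Qed.

End Resampling.

Arguments resample {R T X}.

(** * Reference chain, reachable states and energies *)

Section Guidance.
Variables (R : realType) (X : finType) (Pref Psmall : kernel R X) (r : X -> R).
Variables (xT : X) (lam D L : R) (I M K : nat).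
Hypotheses (M_gt0 : (0 < M)%N) (K_gt0 : (0 < K)%N).
Hypothesis Pref_dist : forall n x, (1 <= n <= I)%N -> is_dist (Pref n x).
Hypothesis Psmall_dist : forall n x, (n < I)%N -> is_dist (Psmall n x).
Hypothesis r_bound : forall x, - D <= r x <= D.
Hypothesis lam_gt0 : 0 < lam.
Hypothesis L_gt0 : 0 < L.
Hypothesis Pref_le : forall n x, (n < I)%N ->
  0 < pref_fwd Pref I xT (I - n) x ->
  forall x0, pref_post Pref n x x0 <= L * Psmall n x x0.

Let B : R := expR (D / lam).
(** The normalising constant of the chain restarted at [x] on level [n] is the energy of [x]; at
    [xT] on level [I] it is [C]. *)
Let energy (n : nat) (x : X) : R := Cnorm Pref r lam n x.
Let reachable (n : nat) (x : X) : bool := 0 < pref_fwd Pref I xT (I - n) x.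

Lemma pref_fwd_ge0 k x : (k <= I)%N -> 0 <= pref_fwd Pref I xT k x.
Proof.
elim: k x => [|k IH] x kI /=; first exact: ler0n.
apply: sumr_ge0 => x' _; apply: mulr_ge0; first exact/IH/ltnW.
have [|+ _] := Pref_dist (I - k) x'; last exact.
by rewrite subn_gt0 kI leq_subr.
Qed.

Lemma reachable_step n x x' : (n < I)%N -> reachable n.+1 x ->
  0 < Pref n.+1 x x' -> reachable n x'.
Proof.
move=> nI; rewrite /reachable => rx px.
rewrite (_ : (I - n = (I - n.+1).+1)%N); last by rewrite subnSK.
rewrite /= (bigD1 x)//= ltr_wpDr//.
  apply: sumr_ge0 => y _; apply: mulr_ge0; first exact/pref_fwd_ge0/leq_subr.
  have [|+ _] := Pref_dist (I - (I - n.+1)) y; last exact.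
  by rewrite subKn.
by rewrite mulr_gt0// subKn.
Qed.

Lemma pref_post_dist n x : (n <= I)%N -> is_dist (pref_post Pref n x).
Proof.
elim: n x => [|n IH] x nI /=.
  split=> [y|]; first exact: ler0n.
  rewrite (bigD1 x)//= eqxx big1 ?addr0// => y.
  by rewrite eq_sym => /negPf ->.
have [p0 p1] : is_dist (Pref n.+1 x) by exact: Pref_dist.
split=> [y|].
  by apply: sumr_ge0 => x' _; rewrite mulr_ge0//; have [] := IH x' (ltnW nI).
rewrite exchange_big /= -[RHS]p1; apply: eq_bigr => x' _.
by have [_ h] := IH x' (ltnW nI); rewrite -mulr_sumr h mulr1.
Qed.

Lemma wgt_bounds x : B^-1 <= wgt r lam x <= B.
Proof.
have /andP[r1 r2] := r_bound x.
by rewrite /B -expRN /wgt !ler_expR -mulNr !ler_pM2r ?invr_gt0// r1 r2.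
Qed.

Lemma energy_bounds n x : (n <= I)%N -> B^-1 <= energy n x <= B.
Proof.
move=> nI; have pd := pref_post_dist n x nI.
apply/andP; split; [apply: (mean_ge _ _ _ pd)|apply: (mean_le _ _ _ pd)] => y _.
  by have /andP[] := wgt_bounds y.
by have /andP[] := wgt_bounds y.
Qed.

Lemma energy_gt0 n x : (n <= I)%N -> 0 < energy n x.
Proof.
move=> nI; have /andP[h _] := energy_bounds n x nI.
by apply: lt_le_trans h; rewrite invr_gt0 expR_gt0.
Qed.

(** Tower property. It makes [Pref n.+1 x x' * energy n x' / energy n.+1 x] a probability kernel,
    the transition of the target chain. *)
Lemma energyS n x :
  energy n.+1 x = \sum_x' Pref n.+1 x x' * energy n x'.
Proof.
rewrite /energy /Cnorm /=; under eq_bigr do rewrite mulr_suml.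
rewrite exchange_big /=; apply: eq_bigr => x' _.
by rewrite mulr_sumr; apply: eq_bigr => y _; rewrite mulrA.
Qed.

(** * Mean and variance of the importance-sampling estimate *)

Let ratio (n : nat) (x y : X) : R :=
  pref_post Pref n x y / Psmall n x y * wgt r lam y.

(** Domination by [L * Psmall] forces [pref_post] to vanish wherever [Psmall] does, so division by
    zero loses no mass. *)
Lemma ratio_mean n x : (n < I)%N -> reachable n x ->
  \sum_y Psmall n x y * ratio n x y = energy n x.
Proof.
move=> nI rx; apply: eq_bigr => y _; rewrite /ratio mulrA; congr (_ * _).
have [post0 _] := pref_post_dist n x (ltnW nI).
have [s0|s0] := eqVneq (Psmall n x y) 0; last by rewrite mulrC divfK.
rewrite s0 mul0r; apply/eqP; rewrite eq_le post0 /=.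
by have := Pref_le n x nI rx y; rewrite s0 mulr0.
Qed.

Lemma ratio_bounds n x y : (n < I)%N -> reachable n x -> 0 < Psmall n x y ->
  0 <= ratio n x y <= L * B.
Proof.
move=> nI rx s0; have [post0 _] := pref_post_dist n x (ltnW nI).
have /andP[_ wB] := wgt_bounds y.
have w0 : 0 <= wgt r lam y := expR_ge0 _.
have q0 : 0 <= pref_post Pref n x y / Psmall n x y by rewrite divr_ge0// ltW.
by rewrite mulr_ge0//= ler_pM// ler_pdivrMr// Pref_le.
Qed.

Lemma est_mean n x : (n < I)%N -> reachable n x ->
  \sum_z iid (Psmall n x) K z * est Pref Psmall r lam K n x z = energy n x.
Proof.
move=> nI rx; rewrite -(ratio_mean n x nI rx).
exact: (iid_avg _ _ _ (Psmall_dist n x nI) K (ratio n x)).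
Qed.

(** A single ratio and its mean both lie in [[0, L * B]]; averaging [K] samples divides the variance
    by [K]. *)
Lemma est_var n x : (n < I)%N -> reachable n x ->
  \sum_z iid (Psmall n x) K z *
    (est Pref Psmall r lam K n x z - energy n x) ^+ 2 <= (L * B) ^+ 2 / K%:R.
Proof.
move=> nI rx; have sd := Psmall_dist n x nI.
have mE := ratio_mean n x nI rx.
rewrite -mE (iid_avg_var _ _ _ sd K (ratio n x) K_gt0) mulrC ler_wpM2r ?invr_ge0//.
apply: (mean_le _ _ _ sd) => y sy; rewrite mE.
have /andP[q0 q1] := ratio_bounds n x y nI rx sy.
have e0 := ltW (energy_gt0 n x (ltnW nI)).
have e1 : energy n x <= L * B.
  rewrite -mE; apply: (mean_le _ _ _ sd) => y' sy'.
  by have /andP[] := ratio_bounds n x y' nI rx sy'.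
have LB0 : 0 <= L * B by apply: le_trans e1.
rewrite -(real_normK (num_real (_ - _))) lerXn2r ?nnegrE//.
by rewrite ler_norml; apply/andP; split; lra.
Qed.

(** * Candidates paired with their proposal samples *)

Let cand (n : nat) (x : X) (t : X * {ffun 'I_K -> X}) : R :=
  Pref n.+1 x t.1 * iid (Psmall n t.1) K t.2.

Let score (n : nat) (t : X * {ffun 'I_K -> X}) : R :=
  est Pref Psmall r lam K n t.1 t.2.

Lemma sum_cand n x (F : X * {ffun 'I_K -> X} -> R) (P : pred X) :
  \sum_(t | P t.1) cand n x t * F t =
  \sum_(a | P a) Pref n.+1 x a * \sum_z iid (Psmall n a) K z * F (a, z).
Proof.
transitivity (\sum_(a | P a) \sum_z cand n x (a, z) * F (a, z)).
  by rewrite pair_big /=; apply: eq_big => [t|[]//]; rewrite andbT.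
apply: eq_bigr => a _; rewrite mulr_sumr.
by apply: eq_bigr => z _; rewrite /cand mulrA.
Qed.

Lemma cand_dist n x : (n < I)%N -> is_dist (cand n x).
Proof.
move=> nI; have [p0 p1] : is_dist (Pref n.+1 x) by exact: Pref_dist.
have id a := iid_dist R X _ (Psmall_dist n a nI) K.
split=> [[a z]|]; first by rewrite mulr_ge0//; have [] := id a.
have := sum_cand n x (fun=> 1) xpredT.
under eq_bigr do rewrite mulr1.
move=> ->; rewrite -[RHS]p1; apply: eq_bigr => a _.
under eq_bigr do rewrite mulr1.
by have [_ ->] := id a; rewrite mulr1.
Qed.

Lemma score_ge0 n t : (n < I)%N -> 0 <= score n t.
Proof.
move=> nI; rewrite /score /est mulr_ge0 ?invr_ge0// sumr_ge0// => k _.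
have [post0 _] := pref_post_dist n t.1 (ltnW nI).
have [s0 _] := Psmall_dist n t.1 nI.
by rewrite mulr_ge0 ?expR_ge0// divr_ge0.
Qed.

(** A pair of families is a family of pairs: once each candidate carries its own samples, the [M]
    draws are i.i.d. and the general resampling bound applies. *)
Lemma ets_stepE n x x' :
  ets_step Pref Psmall r lam M K n.+1 x x' =
  resample (cand n x) (score n) fst M x'.
Proof.
rewrite /ets_step /resample pair_bigA /=.
rewrite (reindex (fun w : {ffun 'I_M -> X * {ffun 'I_K -> X}} =>
  ([ffun j => (w j).1], [ffun j => (w j).2]) :
  {ffun 'I_M -> X} * {ffun 'I_M -> {ffun 'I_K -> X}}))/=; last first.
  exists (fun p : {ffun 'I_M -> X} * {ffun 'I_M -> {ffun 'I_K -> X}} =>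
    [ffun j => (p.1 j, p.2 j)]) => [w|[c z]] _.
    by apply/ffunP => j; rewrite !ffunE -surjective_pairing.
  by congr pair; apply/ffunP => j; rewrite !ffunE.
apply: eq_bigr => w _; congr (_ * _).
  rewrite /iid -big_split /=; apply: eq_bigr => m _.
  by rewrite /cand /iid !ffunE; congr (_ * _); apply: eq_bigr => k _; rewrite ffunE.
rewrite (_ : [ffun j => _] = [ffun j => score n (w j)]); last first.
  by apply/ffunP => j; rewrite !ffunE.
by apply: eq_bigl => m; rewrite ffunE.
Qed.

(* Where [Pref] charges a state, [score] is an unbiased estimate of its energy;
   elsewhere the bias is multiplied by zero. *)
Lemma score_mean n x (P : pred X) : (n < I)%N -> reachable n.+1 x ->
  \sum_(t | P t.1) cand n x t * score n t =
  \sum_(a | P a) Pref n.+1 x a * energy n a.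
Proof.
move=> nI rx; have [p0 _] : is_dist (Pref n.+1 x) by exact: Pref_dist.
rewrite sum_cand; apply: eq_bigr => a _.
have := p0 a; rewrite le_eqVlt => /predU1P[<-|pa]; first by rewrite !mul0r.
by rewrite -(est_mean n a nI)//; exact: reachable_step rx pa.
Qed.

(** Conditioning on the candidate [a] splits the second moment into the variance of its estimate and
    the squared gap [b] between two energies in [[B^-1, B]]. *)
Lemma score_var n x : (n < I)%N -> reachable n.+1 x ->
  \sum_t cand n x t * (score n t - energy n.+1 x) ^+ 2 <=
  (B - B^-1) ^+ 2 + (L * B) ^+ 2 / K%:R.
Proof.
move=> nI rx; have pd : is_dist (Pref n.+1 x) by exact: Pref_dist.
rewrite (sum_cand _ _ (fun t => (score n t - energy n.+1 x) ^+ 2) xpredT) /=.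
apply: (mean_le _ _ _ pd) => a pa.
have ra := reachable_step n x a nI rx pa.
have [i0 i1] := iid_dist R X _ (Psmall_dist n a nI) K.
set b := energy n a - energy n.+1 x.
(* The square is expanded around [energy n a]; the terms linear in the deviation cancel by
   unbiasedness. *)
rewrite (eq_bigr (fun z => iid (Psmall n a) K z *
     (est Pref Psmall r lam K n a z - energy n a) ^+ 2 +
   (2 * b * (iid (Psmall n a) K z * est Pref Psmall r lam K n a z) +
   (b ^+ 2 - 2 * b * energy n a) * iid (Psmall n a) K z))) => [|z _]; last first.
  rewrite /score /b; ring.
rewrite 2!big_split /= -!mulr_sumr i1 est_mean// mulr1.
rewrite [X in _ + X](_ : _ = b ^+ 2); last by ring.
rewrite addrC lerD ?est_var//.
have /andP[e1 e2] := energy_bounds n a (ltnW nI).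
have /andP[e3 e4] := energy_bounds n.+1 x nI.
have BB : 0 <= B - B^-1 by lra.
rewrite -(real_normK (num_real b)) lerXn2r ?nnegrE//.
by rewrite ler_norml; apply/andP; split; rewrite /b; lra.
Qed.

(** * Error of one guidance step and of the whole chain *)

Lemma ets_step_error n x s : (n < I)%N -> reachable n.+1 x -> 0 < s ->
  (B - B^-1) ^+ 2 + (L * B) ^+ 2 / K%:R <= M%:R * s ^+ 2 ->
  \sum_x' `|energy n.+1 x * ets_step Pref Psmall r lam M K n.+1 x x' -
            Pref n.+1 x x' * energy n x'| <= s.
Proof.
move=> nI rx s0 hs.
have cE : \sum_t cand n x t * score n t = energy n.+1 x.
  by rewrite (score_mean n x xpredT)// energyS.
have := resample_error R _ X (cand n x) (score n) fst M (cand_dist n x nI)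
  (fun t => score_ge0 n t nI) M_gt0 s s0.
rewrite cE => /(_ (le_trans (score_var n x nI rx) hs)).
apply: le_trans; apply: ler_sum => x' _.
by rewrite (score_mean n x (pred1 x'))// big_pred1_eq ets_stepE.
Qed.

Lemma ets_step_dist n x : (n < I)%N ->
  is_dist (ets_step Pref Psmall r lam M K n.+1 x).
Proof.
move=> nI; have [p0 p1] := resample_dist R _ X (cand n x) (score n) fst M
  (cand_dist n x nI) (fun t => score_ge0 n t nI) M_gt0.
split=> [x'|]; first by rewrite ets_stepE.
by rewrite -[RHS]p1; apply: eq_bigr => x' _; rewrite ets_stepE.
Qed.

Lemma ets_law_dist n x : (n <= I)%N ->
  is_dist (ets_law Pref Psmall r lam M K n x).
Proof.
elim: n x => [|n IH] x nI /=; first exact: (pref_post_dist 0).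
have [p0 p1] := ets_step_dist n x nI.
split=> [y|].
  by apply: sumr_ge0 => x' _; rewrite mulr_ge0//; have [] := IH x' (ltnW nI).
rewrite exchange_big /= -[RHS]p1; apply: eq_bigr => x' _.
by have [_ h] := IH x' (ltnW nI); rewrite -mulr_sumr h mulr1.
Qed.

Lemma target_dist n x : (n <= I)%N -> is_dist (target Pref r lam n x).
Proof.
move=> nI; have [p0 _] := pref_post_dist n x nI.
have e0 := energy_gt0 n x nI.
split=> [y|]; first by rewrite divr_ge0 ?(ltW e0)// mulr_ge0 ?expR_ge0.
by rewrite -mulr_suml divff// lt0r_neq0.
Qed.

(* Multiplying the error at level [n] by the energy turns the transition
   kernel of the target chain into the reference kernel, so the one-step errors
   add up without ever dividing by a local energy. *)
Lemma ets_law_error n x s : (n <= I)%N -> reachable n x -> 0 < s ->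
  (B - B^-1) ^+ 2 + (L * B) ^+ 2 / K%:R <= M%:R * s ^+ 2 ->
  \sum_y `|energy n x * ets_law Pref Psmall r lam M K n x y -
           pref_post Pref n x y * wgt r lam y| <= n%:R * s.
Proof.
move=> + + s0 hs; elim: n x => [|n IH] x nI rx.
  rewrite mul0r big1// => y _ /=.
  have -> : energy 0 x = wgt r lam x.
    rewrite /energy /Cnorm /= (bigD1 x)//= eqxx mul1r big1 ?addr0// => z.
    by rewrite eq_sym => /negPf ->; rewrite mul0r.
  by case: eqP => [<-|_]; rewrite ?mulr1 ?mul1r ?mulr0 ?mul0r subrr normr0.
have pd : is_dist (Pref n.+1 x) by exact: Pref_dist.
have [p0 p1] := pd.
pose Q := ets_law Pref Psmall r lam M K.
pose S := ets_step Pref Psmall r lam M K.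
(* Inserts the hybrid that makes the first move with the energy-weighted reference kernel and then
   follows the algorithm: the first sum is the one-step error, the second the inductive error
   averaged over [Pref]. *)
have split_error y : `|energy n.+1 x * Q n.+1 x y -
      pref_post Pref n.+1 x y * wgt r lam y| <=
    \sum_x' `|energy n.+1 x * S n.+1 x x' - Pref n.+1 x x' * energy n x'| * Q n x' y +
    \sum_x' Pref n.+1 x x' *
      `|energy n x' * Q n x' y - pref_post Pref n x' y * wgt r lam y|.
  have -> : Q n.+1 x y = \sum_x' S n.+1 x x' * Q n x' y by [].
  have -> : pref_post Pref n.+1 x y =
      \sum_x' Pref n.+1 x x' * pref_post Pref n x' y by [].
  rewrite -big_split mulr_sumr mulr_suml -sumrB.
  apply: (le_trans (ler_norm_sum _ _ _)); apply: ler_sum => x' _.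
  have [q0 _] := ets_law_dist n x' (ltnW nI).
  rewrite -[X in _ <= _ * X + _](ger0_norm (q0 y)).
  rewrite -[X in _ <= _ + X * _](ger0_norm (p0 x')) -!normrM.
  apply: le_trans (ler_normD _ _); rewrite le_eqVlt; apply/orP; left.
  apply/eqP; congr (`|_|); rewrite /Q; ring.
apply: (le_trans (ler_sum _ (fun y _ => split_error y))).
rewrite big_split /= -natr1 mulrDl mul1r addrC; apply: lerD.
  rewrite exchange_big /=; under eq_bigr do rewrite -mulr_sumr.
  apply: (mean_le _ _ _ pd) => x' px; apply: IH; first exact: ltnW.
  exact: reachable_step rx px.
rewrite exchange_big /=; apply: le_trans (ets_step_error n x s nI rx s0 hs).
apply: ler_sum => x' _; have [_ q1] := ets_law_dist n x' (ltnW nI).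
by rewrite -mulr_sumr q1 mulr1.
Qed.

Lemma ets_TV_le1 :
  TV (ets_law Pref Psmall r lam M K I xT) (target Pref r lam I xT) <= 1.
Proof.
have [q0 q1] := ets_law_dist I xT (leqnn I).
have [p0 p1] := target_dist I xT (leqnn I).
rewrite /TV ler_pdivrMl// mulr1.
apply: (@le_trans _ _ (\sum_x
    (ets_law Pref Psmall r lam M K I xT x + target Pref r lam I xT x))).
  by apply: ler_sum => x _; apply: le_trans (ler_normB _ _) _; rewrite !ger0_norm.
by rewrite big_split /= q1 p1.
Qed.

(** Dividing the accumulated error by [C] normalises the target; the factor 2 is the half in
    [TV]. *)
Lemma ets_TV_le s : 0 < s ->
  (B - B^-1) ^+ 2 + (L * B) ^+ 2 / K%:R <= M%:R * s ^+ 2 ->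
  TV (ets_law Pref Psmall r lam M K I xT) (target Pref r lam I xT) <=
  I%:R * (s / (2 * Cnorm Pref r lam I xT)).
Proof.
move=> s0 hs; have c0 := energy_gt0 I xT (leqnn I).
have rT : reachable I xT by rewrite /reachable subnn /= eqxx ltr01.
have := ets_law_error I xT s (leqnn I) rT s0 hs.
rewrite /TV invfM mulrA mulrCA mulrA => h.
rewrite [leRHS](_ : _ = 2^-1 * (I%:R * s / energy I xT)); last first.
  by rewrite /energy; field; rewrite lt0r_neq0.
rewrite ler_pM2l ?invr_gt0// ler_pdivlMr// mulrC mulr_sumr.
apply: le_trans h; apply: ler_sum => y _.
rewrite -{1}(gtr0_norm c0) -normrM mulrBr /target -/(energy I xT).
by rewrite [X in _ - X]mulrC divfK// lt0r_neq0.
Qed.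

End Guidance.

(** * Explicit constants and the final bound *)

Theorem theorem1 (R : realType) (X : finType)
  (Pref Psmall : kernel R X) (r : X -> R) (xT : X)
  (lam D L eps : R) (I M K : nat) :
  (0 < I)%N -> (0 < M)%N -> (0 < K)%N ->
  (forall n x, (1 <= n <= I)%N -> is_dist (Pref n x)) ->
  (forall n x, (n < I)%N -> is_dist (Psmall n x)) ->
  (forall x0, - D <= r x0 <= D) ->
  0 < lam -> 0 < L -> 0 < eps ->
  (* p_ref <= L p_small at every state reachable (visitable) on levels 0..I-1 *)
  (forall n x, (n < I)%N -> 0 < pref_fwd Pref I xT (I - n) x ->
     forall x0, pref_post Pref n x x0 <= L * Psmall n x x0) ->
  0 < Cnorm Pref r lam I xT - eps - gfun eps M K L lam D ->
  TV (ets_law Pref Psmall r lam M K I xT) (target Pref r lam I xT)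
  <= I%:R * ((2 * eps + gfun eps M K L lam D) /
             (Cnorm Pref r lam I xT - eps - gfun eps M K L lam D))
     + 4 * I%:R * expR (- (2 * K%:R * eps ^+ 2 / (L ^+ 2 * expR (2 * D / lam)))).
Proof.
move=> I0 M0 K0 Pref_dist Psmall_dist r_bound lam0 L0 eps0 Pref_le.
set C := Cnorm _ _ _ _ _; set g := gfun _ _ _ _ _ _ => Cpos.
set B := expR (D / lam); set u := 2 * K%:R * eps ^+ 2 / _.
have B0 : 0 < B := expR_gt0 _.
have D0 : 0 <= D by have := r_bound xT; lra.
have B1 : 1 <= B by rewrite -expR0 ler_expR divr_ge0// ltW.
have BE : expR (2 * D / lam) = B ^+ 2.
  by rewrite -mulrA mulr_natl mulr2n expRD expr2.
have K0R : 0 < K%:R :> R by rewrite ltr0n.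
have M1R : 1 <= M%:R :> R by rewrite ler1n.
have M0R : 0 < M%:R :> R by rewrite ltr0n.
have I1R : 1 <= I%:R :> R by rewrite ler1n.
have Bi : B^-1 <= 1 by rewrite invf_le1.
have LB0 : 0 < L ^+ 2 * B ^+ 2 by rewrite mulr_gt0// exprn_gt0.
have uE : u = 2 * K%:R * eps ^+ 2 / (L ^+ 2 * B ^+ 2) by rewrite /u BE.
have u0 : 0 <= u by rewrite uE divr_ge0 ?(ltW LB0)// !mulr_ge0 ?sqr_ge0// ltW.
have gE : g = (B - B^-1) / 2 * Num.sqrt (2 * u / M%:R).
  rewrite /g /gfun BE expRN -/B; congr (_ * Num.sqrt _).
  by rewrite uE; field; rewrite !lt0r_neq0.
have g0 : 0 <= g by rewrite gE mulr_ge0 ?sqrtr_ge0// divr_ge0//; lra.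
have ratio0 : 0 <= (2 * eps + g) / (C - eps - g) by rewrite divr_ge0 ?(ltW Cpos)//; lra.
(* For [u < 1/2], [expR (- u) >= 1 - u >= 1/4], so the exponential term alone is at least 1. *)
have [u_small|u_large] := ltP u 2^-1.
  have exp_ge : 4^-1 <= expR (- u) by apply: le_trans (expR_ge1Dx _); lra.
  apply: (@le_trans _ _ 1).
    by apply: (ets_TV_le1 _ _ _ _ _ _ _ D).
  have : 0 <= I%:R * ((2 * eps + g) / (C - eps - g)) by rewrite mulr_ge0.
  have : 1 <= 4 * I%:R * expR (- u) by nra.
  lra.
(* This is [u >= 1/2] with denominators cleared. *)
have LBeps : (L * B) ^+ 2 / K%:R <= 4 * eps ^+ 2.
  rewrite ler_pdivrMr// exprMn.
  move: u_large; rewrite uE ler_pdivlMr//; lra.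
(* By [gE], the right-hand side is [2 * u * (B - B^-1)^2], and [2 * u >= 1]. *)
have gsq : (B - B^-1) ^+ 2 <= 4 * (M%:R * g ^+ 2).
  have uM0 : 0 <= 2 * u / M%:R by rewrite divr_ge0// mulr_ge0.
  rewrite gE exprMn sqr_sqrtr//.
  rewrite [leRHS](_ : _ = (B - B^-1) ^+ 2 * (2 * u)); last first.
    by field; rewrite !lt0r_neq0.
  by rewrite ler_peMr ?sqr_ge0//; lra.
(* The choice [s = 2 * (2 * eps + g)] works because [M * s^2 >= 4 * M * g^2 + 4 * eps^2] when
   [M >= 1]. *)
apply: (@le_trans _ _ (I%:R * ((2 * (2 * eps + g)) / (2 * C)))).
  apply: (ets_TV_le _ _ _ _ _ _ _ D L) => //; first by lra.
  rewrite -/B; apply: (le_trans (lerD gsq LBeps)).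
  have : 0 <= eps * g by rewrite mulr_ge0// ltW.
  have := sqr_ge0 eps; nra.
(* The exponential term is nonnegative, and shrinking the denominator from [C] to [C - eps - g]
   enlarges the quotient. *)
rewrite -[leLHS]addr0; apply: lerD; last by rewrite !mulr_ge0 ?expR_ge0.
have C0 : 0 < C by lra.
have -> : 2 * (2 * eps + g) / (2 * C) = (2 * eps + g) / C.
  by field; exact: lt0r_neq0.
apply: ler_wpM2l; first by lra.
apply: ler_wpM2l; first by lra.
by rewrite lef_pV2 ?posrE//; lra.
Qed.
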